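(* Let $X,Y$ be Banach spaces over $\mathbb{K}$. Suppose that the pair $(X,\mathbb{K})$ has property $\mathbf{L}_{p,o}$ and that $Y$ has property $\beta$ with a finite index set $I$ and constant $\rho$. Then the pair $(X,Y)$ has property $\mathbf{L}_{p,o}$.
   Context: Banach spaces are over $\mathbb{K}$, which is $\mathbb{R}$ or $\mathbb{C}$. $S_X$ denotes the unit sphere of $X$, $X^*$ its topological dual, and $\mathcal{L}(X,Y)$ the space of bounded linear operators from $X$ to $Y$ with the operator norm (so $\mathcal{L}(X,\mathbb{K})=X^*$). A pair $(X,Y)$ of Banach spaces has property $\mathbf{L}_{p,o}$ if for every $\varepsilon>0$ and every $T\in\mathcal{L}(X,Y)$ with $\|T\|=1$ there is $\eta(\varepsilon,T)>0$ such that whenever $x\in S_X$ satisfies $\|T(x)\|>1-\eta(\varepsilon,T)$, there is $S\in\mathcal{L}(X,Y)$ with $\|S\|=1$, $\|S(x)\|=1$ and $\|S-T\|<\varepsilon$. A Banach space $Y$ has property $\beta$ (of Lindenstrauss) with index set $I$ and constant $0\leq\rho<1$ if there is a set $\{(y_i,y_i^* ): i\in I\}\subset S_Y\times S_{Y^*}$ such that: $y_i^*(y_i)=1$ for all $i\in I$; $|y_i^*(y_j)|\leq\rho<1$ for all $i,j\in I$ with $i\neq j$; and $\|y\|=\sup_{i\in I}|y_i^*(y)|$ for all $y\in Y$. *)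

(* Defs.v *)
From HB Require Import structures.
From mathcomp Require Import all_boot all_order all_algebra.
From mathcomp Require Import complex.
From mathcomp Require Import boolp classical_sets reals topology normedtype.
Set Implicit Arguments.
Unset Strict Implicit.
Unset Printing Implicit Defensive.
Import Order.TTheory GRing.Theory Num.Theory.
Import numFieldNormedType.Exports.
Local Open Scope classical_set_scope.
Local Open Scope ring_scope.

(* Norms in a [normedModType K] take their values in [K]. When [K] is [R[i]],
   [0 <= z] and [0 < z] entail that [z] is real, so an [eps : K] with
   [0 < eps] is a positive real number. *)
Definition real_or_complex (R : realType) (K : numFieldType) : Prop :=
  K = (R : numFieldType) \/ K = (R[i] : numFieldType).

Section operators.
Context {K : numFieldType}.

Definition bounded_op (X Y : normedModType K) (T : {linear X -> Y}) : Prop :=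
  exists M : K, forall x, `|T x| <= M * `|x|.

(* The norm is stated for bare functions so that it applies to [S \- T]. The
   value 0 is the supremum of the empty set and a junk value when there is no
   least upper bound, which over R and R[i] cannot happen for a bounded
   operator. *)
Definition opnorm (X Y : normedModType K) (T : X -> Y) : K :=
  supremum 0 [set `|T x| | x in [set x : X | `|x| <= 1]].

Definition Lpo (X Y : normedModType K) : Prop :=
  forall (eps : K) (T : {linear X -> Y}),
    0 < eps -> bounded_op T -> opnorm T = 1 ->
  exists2 eta : K, 0 < eta &
    forall x : X, `|x| = 1 -> 1 - eta < `|T x| ->
    exists S : {linear X -> Y},
      [/\ bounded_op S, opnorm S = 1, `|S x| = 1 & opnorm (S \- T) < eps].

(* [K^o] is [K] seen as a normed space over itself. With [I] empty, the last
   condition says that [Y] is the zero space. *)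
Definition property_beta (Y : normedModType K) (I : Type) (rho : K) : Prop :=
  0 <= rho < 1 /\
  exists (y : I -> Y) (ys : I -> {linear Y -> K^o}),
    [/\ forall i, `|y i| = 1,
        forall i, bounded_op (ys i) /\ opnorm (ys i) = 1,
        forall i, ys i (y i) = 1,
        forall i j, i <> j -> `|ys i (y j)| <= rho
      & forall z : Y, `|z| = supremum 0 (range (fun i => `|ys i z| : K))].

End operators.

(* Main.v *)
Require Import Defs.
From HB Require Import structures.
From mathcomp Require Import all_boot all_order all_algebra.
From mathcomp Require Import complex.
From mathcomp Require Import boolp classical_sets reals topology normedtype.
From mathcomp Require Import ring.
Set Implicit Arguments.
Unset Strict Implicit.
Unset Printing Implicit Defensive.

Import Order.TTheory GRing.Theory Num.Theory.
Import numFieldNormedType.Exports.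
Local Open Scope ring_scope.

(** Only finitely many functionals norm [Y], so an operator [T] of norm 1
    whose value at a unit vector [x] has norm close to 1 has a coordinate
    [t = ys i \o T] with [`|t x|] close to 1. The threshold [eta] is chosen
    below the thresholds of all the coordinates: a coordinate of norm 1 has the
    one given by the property of [(X, K)], and a coordinate of norm < 1 has
    [1 - opnorm t], which no unit vector can beat. Hence [t] has norm 1 and
    there is a functional [s] of norm 1, close to [t], with [`|s x| = 1].

    It remains to replace the coordinate [t] of [T] by [s]
    ([perturb_coordinate]). The obvious candidate [T + (s - t) y_i] disturbs
    every other coordinate by at most [rho * opnorm (s - t)], which may push its
    norm beyond 1. As [rho < 1], enough room is made by giving the coordinate
    [i] the norm [1 + d] before normalising:
    [S = (1 + d)^-1 (T + ((1 + d) s - t) y_i) = s y_i + (1 + d)^-1 (T - t y_i)].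
    Its coordinate [i] is exactly [s], and its other coordinates have norm at
    most 1 as soon as [opnorm (s - t) <= d (1 - rho)]. So [S] has norm 1,
    attains it at [x], and is within [3 d] of [T].

    Both the operator norm and the norm of [Y] are suprema of sets of
    nonnegative scalars in [K]; [supremum_lub] says that such suprema are least
    upper bounds, and everything else is derived from this uniformly in [K]. *)

(** * Suprema of nonnegative scalars *)

(** Comparable complex numbers have the same imaginary part, so over [R[i]] the
    elements of [A] and all its upper bounds are real and the real parts carry
    the supremum. *)
Lemma has_lub (R : realType) (K : numFieldType) (A : set K) (M : K) :
  real_or_complex R K -> (A !=set0)%classic ->
  (forall a, A a -> 0 <= a <= M) -> (supremums A !=set0)%classic.
Proof.
case=> ?; subst K => -[a0 Aa0] A_bnd.
  have hA : has_sup A by split; [exists a0 | exists M => a /A_bnd/andP[]].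
  exists (sup A); split; first exact: sup_upper_bound.
  by move=> u ub_u; apply: ge_sup => //; exists a0.
have /andP[a0_ge0 a0M] := A_bnd _ Aa0.
have hB : has_sup (@complex.Re R @` A)%classic.
  split; first by exists (complex.Re a0), a0.
  exists (complex.Re M) => _ [a /A_bnd/andP[_ aM] <-].
  by move: aM; rewrite lecE => /andP[].
exists (Complex (sup (@complex.Re R @` A)%classic) 0); split.
  move=> a Aa; rewrite lecE; apply/andP; split.
    have /andP[a_ge0 _] := A_bnd _ Aa.
    by move: a_ge0; rewrite lecE => /andP[/eqP/= ->].
  by apply: sup_upper_bound => //; exists a.
move=> u ub_u; rewrite lecE; apply/andP; split.
  have := le_trans a0_ge0 (ub_u _ Aa0).
  by rewrite lecE => /andP[/eqP/= ->].
apply: ge_sup => [|_ [a Aa <-]]; first exact: hB.1.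
by have := ub_u _ Aa; rewrite lecE => /andP[].
Qed.

Lemma supremum_lub (R : realType) (K : numFieldType) (A : set K) (M : K) :
  real_or_complex R K -> (A !=set0)%classic ->
  (forall a, A a -> 0 <= a <= M) -> supremums A (supremum 0 A).
Proof.
move=> hK A0 A_bnd; rewrite /supremum ifF; last exact/negbTE/set0P.
by have [s As] := has_lub hK A0 A_bnd; apply: xgetI As.
Qed.

(** * Operator norm *)

Section operator_norm.
Context {R : realType} {K : numFieldType} (hK : real_or_complex R K).
Context {X Y : normedModType K}.

Lemma opnorm_lub (T : {linear X -> Y}) : bounded_op T ->
  supremums [set `|T x| | x in [set x : X | `|x| <= 1]]%classic (opnorm T).
Proof.
(* [M] itself can be negative or not real when [X] is zero *)
case=> M TM; apply: (supremum_lub (M := `|M|)) hK _ _.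
  by exists `|T 0|; exists 0 => //=; rewrite normr0.
move=> _ [x /= x1 <-]; rewrite normr_ge0 (le_trans (TM x))//=.
rewrite -[leLHS]ger0_norm ?(le_trans (normr_ge0 _) (TM x))//.
by rewrite normrM normr_id ler_piMr.
Qed.

Lemma le_opnorm (T : {linear X -> Y}) x :
  bounded_op T -> `|T x| <= opnorm T * `|x|.
Proof.
move=> /opnorm_lub[ubT _]; have [->|x0] := eqVneq x 0.
  by rewrite raddf0 !normr0 mulr0.
have nx : 0 < `|x| by rewrite normr_gt0.
rewrite -ler_pdivrMr//; apply: ubT => /=.
exists (`|x|^-1 *: x).
  by rewrite /= normrZ normfV normr_id mulVf ?gt_eqF.
by rewrite linearZ/= normrZ normfV normr_id mulrC.
Qed.

Lemma bounded_op_le (T : {linear X -> Y}) c :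
  (forall x, `|T x| <= c * `|x|) -> bounded_op T.
Proof. by exists c. Qed.

Lemma opnorm_le (T : {linear X -> Y}) c : 0 <= c ->
  (forall x, `|T x| <= c * `|x|) -> opnorm T <= c.
Proof.
move=> c0 Tc; have [_ lubT] := opnorm_lub (bounded_op_le Tc).
apply: lubT => _ [x /= x1 <-].
by rewrite (le_trans (Tc x))// ler_piMr.
Qed.

End operator_norm.

(** * Norming families and rank-one operators *)

(** The bound [0 <= c] matters when [I] is empty, and [Y] is the zero space. *)
Lemma norming_le (R : realType) (K : numFieldType) (hK : real_or_complex R K)
    (Y : normedModType K) (I : Type) (ys : I -> {linear Y -> K^o})
    (norming : forall z : Y, `|z| = supremum 0 (range (fun i => `|ys i z| : K)))
    (z : Y) (c : K) :
  0 <= c -> (forall i, `|ys i z| <= c) -> `|z| <= c.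
Proof.
move=> c0 zc; rewrite norming.
have [i0|noI] := pselect (inhabited I); last first.
  rewrite (_ : (range (fun i => `|ys i z| : K)) = set0)%classic ?supremum0//.
  by rewrite -subset0 => ? [j]; case: noI.
have [] := supremum_lub (A := range (fun i => `|ys i z| : K)) (M := c) hK.
- by case: i0 => i; exists `|ys i z|, i.
- by move=> _ [i _ <-]; rewrite normr_ge0 zc.
by move=> _; apply=> _ [i _ <-].
Qed.

Section rank_one_operator.
Context {K : numFieldType} {X Y : normedModType K}.

Definition rank_one (f : {linear X -> K^o}) (y : Y) (x : X) : Y :=
  (f x : K) *: y.

Fact rank_one_linear f y : linear (rank_one f y).
Proof.
by move=> a u v; rewrite /rank_one linearP/= scalerDl scalerA.
Qed.

HB.instance Definition _ f y :=
  GRing.isLinear.Build K X Y *:%R (rank_one f y) (rank_one_linear f y).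

End rank_one_operator.

(** The order of [K] is not total, so the minimum of the [e i] is replaced by the
    inverse of the sum of their inverses and 1. *)
Lemma finite_pos_lb (K : numFieldType) (I : finType) (e : I -> K) :
  (forall i, 0 < e i) ->
  exists2 d : K, 0 < d <= 1 & forall i, d <= e i.
Proof.
move=> e0; pose s := \sum_i (e i)^-1.
have s0 : 0 <= s by apply: sumr_ge0 => i _; rewrite invr_ge0 ltW.
have s1 : 0 < 1 + s by rewrite ltr_pwDl.
exists (1 + s)^-1.
  by rewrite invr_gt0 s1 invf_le1// lerDl.
move=> i; rewrite -[leRHS]invrK lef_pV2 ?posrE ?invr_gt0//.
rewrite /s (bigD1 i)//= addrCA lerDl addr_ge0// sumr_ge0// => j _.
by rewrite invr_ge0 ltW.
Qed.

(** * Perturbing one coordinate of an operator *)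

(** The summand [s y_i] of [S] is the wanted coordinate [i]. The other summand
    vanishes in that coordinate and is shrunk by [(1 + d)^-1], which leaves room
    in the coordinate [j] for the [rho]-fraction of [s - ys i \o T] that
    [s y_i] adds there. *)
Lemma perturb_coordinate (R : realType) (K : numFieldType)
    (hK : real_or_complex R K) (X Y : normedModType K) (I : finType) (rho : K)
    (y : I -> Y) (ys : I -> {linear Y -> K^o})
    (rho01 : 0 <= rho < 1)
    (y1 : forall i, `|y i| = 1)
    (ys_le : forall i z, `|ys i z| <= `|z|)
    (ysy1 : forall i, ys i (y i) = 1)
    (ysy : forall i j, i <> j -> `|ys i (y j)| <= rho)
    (norming : forall z : Y, `|z| = supremum 0 (range (fun i => `|ys i z| : K)))
    (T : {linear X -> Y}) (i : I) (s : {linear X -> K^o}) (d : K) :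
  0 < d ->
  (forall x, `|T x| <= `|x|) -> (forall x, `|s x| <= `|x|) ->
  (forall x, `|s x - ys i (T x)| <= d * (1 - rho) * `|x|) ->
  exists S : {linear X -> Y},
    [/\ forall x, `|S x| <= `|x|,
        forall x, ys i (S x) = s x
      & forall x, `|S x - T x| <= (d + d + d) * `|x|].
Proof.
have /andP[rho0 rho1] := rho01.
move=> d0 T1 s1 sT.
pose t := (ys i \o T : {linear X -> K^o}).
pose a := (1 + d)^-1.
have d1 : 0 < 1 + d by rewrite addr_gt0.
have a0 : 0 < a by rewrite invr_gt0.
have ad : 1 - a = a * d by rewrite /a; field; rewrite gt_eqF.
have a1 : 0 <= 1 - a by rewrite ad mulr_ge0 ?ltW.
have a1d : 1 - a <= d by rewrite ad ler_piMl ?(ltW d0)// -subr_ge0.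
pose S := (rank_one s (y i) \+ a \*: (T \- rank_one t (y i))) : X -> Y.
exists (S : {linear X -> Y}).
have SE x : S x = s x *: y i + a *: (T x - ys i (T x) *: y i) by [].
have ysZ j (k : K) z : ys j (k *: z) = k * ys j z by rewrite linearZ.
have ysD j u v : ys j (u + v) = ys j u + ys j v by exact: raddfD.
have ysB j u v : ys j (u - v) = ys j u - ys j v by exact: raddfB.
have ysS j x : ys j (S x) = (s x : K) * ys j (y i)
    + a * (ys j (T x) - (ys i (T x) : K) * ys j (y i)).
  by rewrite SE ysD !ysZ ysB ysZ.
split => [x|x|x].
- apply: (norming_le hK norming) => // j.
  have [->|/eqP ji] := eqVneq j i.
    by rewrite ysS ysy1 mulr1 mulr1 subrr mulr0 addr0.
  set b := ys j (y i); have b_rho : `|b| <= rho by exact: ysy.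
  (* a convex combination of [ys j (T x)] and [b * s x], plus an error of size
     at most [d * (1 - rho)], which the slack in [`|b| <= rho] absorbs *)
  have -> : ys j (S x) = a * ys j (T x)
      + (a * (b * (s x - ys i (T x))) + (1 - a) * (b * s x)) :> K.
    by rewrite ysS -/b; ring.
  have B1 : `|a * ys j (T x)| <= a * `|x|.
    rewrite normrM (gtr0_norm a0) ler_pM2l//.
    exact: le_trans (ys_le _ _) (T1 _).
  have B2 : `|a * (b * (s x - ys i (T x)))| <= a * (d * (1 - rho) * `|x|).
    rewrite normrM (gtr0_norm a0) ler_pM2l// normrM.
    rewrite (le_trans _ (sT x))// ler_piMl ?normr_ge0//.
    exact: le_trans b_rho (ltW rho1).
  have B3 : `|(1 - a) * (b * s x)| <= (1 - a) * (rho * `|x|).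
    by rewrite normrM (ger0_norm a1) ler_wpM2l// normrM ler_pM.
  apply: (le_trans (ler_normD _ _)).
  have -> : `|x| = a * `|x|
      + (a * (d * (1 - rho) * `|x|) + (1 - a) * (rho * `|x|)).
    by rewrite ad /a; field; rewrite gt_eqF.
  by rewrite lerD// (le_trans (ler_normD _ _))// lerD.
- by rewrite ysS ysy1 mulr1 mulr1 subrr mulr0 addr0.
have -> : S x - T x =
    (s x - ys i (T x)) *: y i + ((1 - a) *: (ys i (T x) *: y i) - (1 - a) *: T x).
  rewrite SE scalerBr !scalerBl !scale1r opprB.
  by rewrite [X in _ + X - _]addrC !addrA subrK.
have B1 : `|(s x - ys i (T x)) *: y i| <= d * `|x|.
  rewrite normrZ y1 mulr1 (le_trans (sT x))// ler_wpM2r//.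
  by rewrite ler_piMr ?(ltW d0)// lerBlDr lerDl.
have B2 : `|(1 - a) *: (ys i (T x) *: y i)| <= d * `|x|.
  rewrite !normrZ y1 mulr1 (ger0_norm a1) ler_pM//.
  exact: le_trans (ys_le _ _) (T1 _).
have B3 : `|(1 - a) *: T x| <= d * `|x|.
  by rewrite normrZ (ger0_norm a1) ler_pM.
rewrite !mulrDl -addrA (le_trans (ler_normD _ _))// lerD//.
by rewrite (le_trans (ler_normB _ _))// lerD.
Qed.

Theorem theorem2p8 (R : realType) (K : numFieldType)
    (hK : real_or_complex R K) (X Y : completeNormedModType K)
    (I : finType) (rho : K) :
  Lpo X K^o -> property_beta Y I rho -> Lpo X Y.
Proof.
move=> LX [rho01 [y [ys [y1 ys1 ysy1 ysy norming]]]] eps T eps0 Tb T1.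
have T_le x : `|T x| <= `|x| by rewrite (le_trans (le_opnorm hK x Tb))// T1 mul1r.
have ys_le i z : `|ys i z| <= `|z|.
  by have [b n] := ys1 i; rewrite (le_trans (le_opnorm hK z b))// n mul1r.
pose t i := (ys i \o T : {linear X -> K^o}).
have t_le i x : `|t i x| <= 1 * `|x|.
  by rewrite mul1r; apply: le_trans (ys_le _ _) (T_le _).
have tb i : bounded_op (t i) by exact: bounded_op_le (t_le i).
have t1 i : opnorm (t i) <= 1 by exact: (opnorm_le hK (T := t i)).
pose d := eps / 4.
have d0 : 0 < d by rewrite divr_gt0.
have dr0 : 0 < d * (1 - rho).
  by case/andP: rho01 => _ ?; rewrite mulr_gt0// subr_gt0.
have /choice[eta eta_spec] i : exists e : K, 0 < e /\
    forall x : X, `|x| = 1 -> 1 - e < `|t i x| -> exists s : {linear X -> K^o},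
      [/\ bounded_op s, opnorm s = 1, `|s x| = 1
        & opnorm (s \- t i) < d * (1 - rho)].
  have [n1|n1] := eqVneq (opnorm (t i)) 1.
    by have [e e0 he] := LX _ _ dr0 (tb i) n1; exists e.
  (* no unit vector satisfies the premise for this threshold *)
  exists (1 - opnorm (t i)); split; first by rewrite subr_gt0 lt_neqAle n1 t1.
  move=> x x1; rewrite subKr => /lt_le_trans/(_ (le_opnorm hK x (tb i))).
  by rewrite x1 mulr1 ltxx.
have [e /andP[e0 e1] e_le] := finite_pos_lb (fun i => (eta_spec i).1).
exists e => // x x1 Tx.
(* some coordinate is already large, by [norming_le] with the bound [1 - e],
   which is nonnegative because [e <= 1] *)
have [i ti] : exists i, 1 - e < `|t i x|.
  apply: contrapT => /forallNP no.
  have : `|T x| <= 1 - e.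
    apply: (norming_le hK norming) => [|i]; first by rewrite subr_ge0.
    have := no i; move/negP; rewrite -real_leNgt//.
    by rewrite ger0_real// subr_ge0.
  by move=> /(lt_le_trans Tx); rewrite ltxx.
have [] := (eta_spec i).2 x x1.
  by apply: le_lt_trans ti; rewrite lerD2l lerN2.
move=> s [sb s1 sx st].
have s_le z : `|s z| <= `|z| by rewrite (le_trans (le_opnorm hK z sb))// s1 mul1r.
have stb : bounded_op (s \- t i : {linear X -> K^o}).
  exists 2 => z /=; rewrite mulr_natl mulr2n.
  rewrite (le_trans (ler_normB _ _))// lerD//.
  by rewrite -[leRHS]mul1r t_le.
have st_le z : `|s z - ys i (T z)| <= d * (1 - rho) * `|z|.
  by rewrite (le_trans (le_opnorm hK z stb))// ler_wpM2r// ltW.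
have [S [S_le Si ST]] := perturb_coordinate hK rho01 y1 ys_le ysy1 ysy norming
  d0 T_le s_le st_le.
have S_le1 z : `|S z| <= 1 * `|z| by rewrite mul1r.
have Sb := bounded_op_le S_le1.
have Sx : `|S x| = 1.
  by apply/eqP; rewrite eq_le -{1}x1 S_le -sx -Si ys_le.
exists S; split => //.
  apply/eqP; rewrite eq_le (opnorm_le hK _ S_le1)//=.
  by have := le_opnorm hK x Sb; rewrite x1 Sx mulr1.
have d3 : 0 < d + d + d by rewrite !addr_gt0.
have := opnorm_le hK (T := S \- T : {linear X -> Y}) (ltW d3) ST.
move=> /le_lt_trans; apply.
have -> : eps = d + d + d + d by rewrite /d; field.
by rewrite ltrDl.
Qed.
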